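(* Let $n\ge 2$ and let $f\in\mathcal{S}(\mathbb{R}^n)$. Let $U$ be a non-empty open subset of $\mathbb{R}^n$ and suppose that $$Df(x,\xi)=\int_0^\infty f(x+t\xi)\,dt=0\quad\text{for every }x\in U\text{ and for all }\xi\in\mathbb{R}^n\setminus\{0\}.$$ Then $f\equiv 0$.
   Context: $\mathcal{S}(\mathbb{R}^n)$ is the space of complex-valued Schwartz functions on $\mathbb{R}^n$. *)

(* Defs.v *)
From mathcomp Require Import all_boot all_order all_algebra.
From mathcomp Require Import complex.
From mathcomp Require Import all_classical all_reals all_analysis.

Set Implicit Arguments.
Unset Strict Implicit.
Unset Printing Implicit Defensive.

Import Order.TTheory GRing.Theory Num.Theory.
Import numFieldNormedType.Exports.

Local Open Scope classical_set_scope.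
Local Open Scope ring_scope.
Local Open Scope complex_scope.

(* MathComp-Analysis puts no structure of normed R-space on R[i], so continuity,
   real directional derivatives and integrals of complex-valued functions are
   taken componentwise. [Re] and [Im] are those of the file complex, with values
   in R (not the R[i]-valued ['Re] and ['Im] of numClosedFieldType). *)

Definition ccontinuous (R : realType) (n : nat) (f : 'rV[R]_n -> R[i]) : Prop :=
  continuous (fun x => complex.Re (f x)) /\
  continuous (fun x => complex.Im (f x)).

Definition has_partial (R : realType) (n : nat) (i : 'I_n)
    (f : 'rV[R]_n -> R[i]) : Prop :=
  forall x : 'rV[R]_n,
    derivable (fun y => complex.Re (f y)) x (delta_mx 0 i) /\
    derivable (fun y => complex.Im (f y)) x (delta_mx 0 i).

Definition partial (R : realType) (n : nat) (i : 'I_n)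
    (f : 'rV[R]_n -> R[i]) : 'rV[R]_n -> R[i] :=
  fun x => ('D_(delta_mx 0 i) (fun y => complex.Re (f y)) x) +i*
           ('D_(delta_mx 0 i) (fun y => complex.Im (f y)) x).

Definition smooth (R : realType) (n : nat) (f : 'rV[R]_n -> R[i]) : Prop :=
  forall s : seq 'I_n, let g := foldr (@partial R n) f s in
    ccontinuous g /\ forall i : 'I_n, has_partial i g.

Definition monomial (R : realType) (n : nat) (a : 'I_n -> nat)
    (x : 'rV[R]_n) : R :=
  \prod_(i < n) x 0 i ^+ a i.

Definition mpartial (R : realType) (n : nat) (b : 'I_n -> nat)
    (f : 'rV[R]_n -> R[i]) : 'rV[R]_n -> R[i] :=
  foldr (fun i g => iter (b i) (partial i) g) f (enum 'I_n).

(* The inequality is in R[i], where it means that both sides differ by a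
   nonnegative real; the norm is the complex modulus. *)
Definition schwartz (R : realType) (n : nat) (f : 'rV[R]_n -> R[i]) : Prop :=
  smooth f /\
  forall a b : 'I_n -> nat, exists M : R, forall x : 'rV[R]_n,
    `| (monomial a x)%:C * mpartial b f x | <= M%:C.

Definition divergent_beam (R : realType) (n : nat) (f : 'rV[R]_n -> R[i])
    (x xi : 'rV[R]_n) : R[i] :=
  (\int[@lebesgue_measure R]_(t in `[0, +oo[) complex.Re (f (x + t *: xi))) +i*
  (\int[@lebesgue_measure R]_(t in `[0, +oo[) complex.Im (f (x + t *: xi))).

(* Main.v *)
Require Import Defs.
From mathcomp Require Import all_boot all_order all_algebra.
From mathcomp Require Import complex.
From mathcomp Require Import all_classical all_reals all_analysis.
From mathcomp Require Import measurable_realfun ring lra.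

Import Order.TTheory GRing.Theory Num.Theory.
Import numFieldNormedType.Exports.

Local Open Scope classical_set_scope.
Local Open Scope ring_scope.

(** Real and imaginary parts are treated separately, so let [phi] be real.
    Differences of half-line integrals along one direction show that [phi]
    vanishes on [U], so for [x] in [U] the integrals
      [A_m(x, xi) = int_0^oo phi(x + t xi) t^-m dt]
    converge, and [d/dxi_j A_(m+1) = d/dx_j A_m].
    Put [B_m(x, xi) = A_m(x, xi) + (-1)^m A_m(x, - xi)], the integral of
    [phi(x + t xi) t^-m] over the whole line. If [B_m = 0] for all [x] in [U],
    then [B_(m+1)(x, .)] is locally constant on the nonzero vectors, which
    form a connected set since [n >= 2]. Being odd for [m = 0] and homogeneous
    of degree [m] for [m > 0], it vanishes. Hence [phi], restricted to any line
    through a point of [U], is orthogonal to all polynomials in [1/t], and so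
    is zero. *)

(** * Integrals over a half-line *)

Section halfline.
Context {R : realType}.
Let mu := @lebesgue_measure R.

Lemma continuous_measurable_funS (D : set R) (f : R -> R) :
  continuous f -> measurable_fun D f.
Proof.
by move=> cf; apply: measurable_funTS; exact: continuous_measurable_fun.
Qed.

Lemma integrable_oneDsqrV :
  mu.-integrable `]0, +oo[ (EFin \o (fun t : R => (oneDsqr t)^-1)).
Proof.
have mD D : measurable_fun D (EFin \o (fun t : R => (oneDsqr t)^-1)).
  apply/measurable_EFinP; apply: continuous_measurable_funS.
  exact: continuous_oneDsqrV.
apply/integrableP; split; first exact: mD.
apply: (@le_lt_trans _ _ (\int[mu]_(t in `]0%R, +oo[) ((oneDsqr t)^-1)%R%:E)%E).
  rewrite le_eqVlt; apply/orP; left; apply/eqP; apply: eq_integral => t _ /=.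
  congr EFin; apply: ger0_norm; rewrite invr_ge0.
  by apply: (@le_trans _ _ 1) => //; exact: oneDsqr_ge1.
rewrite integral_itv_obnd_cbnd; last exact: mD.
by rewrite integral0y_oneDsqr ltry.
Qed.

Lemma ge0_integral_affine (c d : R) (G : R -> R) :
  0 < c -> continuous G -> (forall t, 0 <= G t) ->
  (\int[mu]_(t in `[0%R, +oo[) (G (c * t + d)%R * c)%:E =
   \int[mu]_(t in `[d, +oo[) (G t)%:E)%E.
Proof.
move=> c0 cG G0.
pose F t : R := c * t + d.
have dF (t : R) : is_derive t 1 F c.
  rewrite /F; apply: is_derive_eq; rewrite addr0.
  by rewrite /GRing.scale/= mulr1.
have F' : derive1 F = cst c.
  by apply/funext => t; rewrite derive1E; exact: derive_val.
have cF t : F x @[x --> t] --> F t.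
  exact/differentiable_continuous/derivable1_diffP/ex_derive.
have F0 : F 0 = d by rewrite /F mulr0 add0r.
transitivity (\int[mu]_(t in `[F 0%R, +oo[) (G t)%:E)%E; last by rewrite F0.
rewrite (@increasing_ge0_integration_by_substitutiony _ F G 0).
- by apply: eq_integral => t _; rewrite F' /F/= fctE.
- by move=> x y _ _ xy; rewrite /F ltrD2r ltr_pM2l.
- by rewrite F' => ? _; exact: cst_continuous.
- by rewrite F'; exact: is_cvg_cst.
- by rewrite F'; exact: is_cvg_cst.
- split; first by move=> x _; exact: ex_derive.
  exact/cvg_at_right_filter/cF.
- have h : c * t @[t --> +oo] --> +oo by apply: gt0_cvgMry => //; exact: cvg_id.
  exact: (cvg_comp _ _ h (cvg_addrr d)).
- exact: continuous_subspaceT.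
- by move=> x _.
Qed.

(** Positive and negative parts are transformed separately by the nonnegative case. It serves below
    for doubling ([c = 2], [d = 0]) and for translation ([c = 1], [d = u]). *)
Lemma Rintegral_affine (c d : R) (G : R -> R) :
  0 < c -> continuous G ->
  \int[mu]_(t in `]0, +oo[) (G (c * t + d) * c) = \int[mu]_(t in `]d, +oo[) G t.
Proof.
move=> c0 cG.
have cmax (H : R -> R) : continuous H -> continuous (fun t => Num.max (H t) 0).
  by move=> cH t; apply: continuous_max; [exact: cH|exact: cst_continuous].
have cGa : continuous (fun t => G (c * t + d) * c).
  move=> t; apply: cvgM; last exact: cvg_cst.
  apply: (@continuous_comp _ _ _ (fun t => c * t + d) G); last exact: cG.
  by apply: continuousD; [exact: mulrl_continuous|exact: cst_continuous].
rewrite /Rintegral !integral_itv_obnd_cbnd; first last.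
- by apply/measurable_EFinP; exact: continuous_measurable_funS.
- by apply/measurable_EFinP; exact: continuous_measurable_funS.
congr fine.
rewrite integralE [RHS]integralE; congr (_ - _)%E.
- transitivity (\int[mu]_(t in `[0%R, +oo[)
      ((fun t => Num.max (G t) 0) (c * t + d)%R * c)%:E)%E.
    apply: eq_integral => t _.
    by rewrite funeposE -EFin_max maxr_pMl ?ltW// mul0r.
  rewrite (@ge0_integral_affine c d (fun t => Num.max (G t) 0))//.
  + by apply: eq_integral => t _; rewrite funeposE -EFin_max.
  + exact: cmax.
  + by move=> t; rewrite le_max lexx orbT.
- transitivity (\int[mu]_(t in `[0%R, +oo[)
      ((fun t => Num.max (- G t) 0) (c * t + d)%R * c)%:E)%E.
    apply: eq_integral => t _.
    by rewrite funenegE -EFinN -EFin_max maxr_pMl ?ltW// mul0r mulNr.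
  rewrite (@ge0_integral_affine c d (fun t => Num.max (- G t) 0))//.
  + by apply: eq_integral => t _; rewrite funenegE -EFinN -EFin_max.
  + by apply: cmax => t; apply: cvgN; exact: cG.
  + by move=> t; rewrite le_max lexx orbT.
Qed.
End halfline.

(** * Moments in [1/t] determine a function *)

Section moments.
Context {R : realType}.
Let mu := @lebesgue_measure R.

Lemma measurable_funV_gt0 :
  measurable_fun (`]0, +oo[ : set R) (fun t : R => t^-1).
Proof.
apply: open_continuous_measurable_fun; first exact: interval_open.
move=> t; rewrite inE/= in_itv/= andbT => t0.
by apply: inv_continuous; rewrite gt_eqF.
Qed.

(** The product is dominated by [K * G]: the weight [w], typically a power of [t^-1], may blow up at
    0, but only where [G] vanishes. *)
Lemma integrable_mulr_bounded (G w : R -> R) (rho K : R) :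
  mu.-integrable `]0, +oo[ (EFin \o G) ->
  (forall t, 0 < t < rho -> G t = 0) ->
  measurable_fun (`]0, +oo[ : set R) w ->
  (forall t, 0 < t -> rho <= t -> `|w t| <= K) ->
  mu.-integrable `]0, +oo[ (EFin \o (fun t => G t * w t)).
Proof.
move=> iG G0 mw wK.
have mG : measurable_fun (`]0, +oo[ : set R) G.
  by apply/measurable_EFinP; exact: measurable_int iG.
have mD : measurable (`]0, +oo[ : set (measurableTypeR R)) by [].
apply: (le_integrable mD _ _ (integrableZl mD K iG)).
- by apply/measurable_EFinP; exact: measurable_funM.
- move=> t /=; rewrite in_itv/= andbT => t0.
  rewrite lee_fin !normrM mulrC.
  have [tr|rt] := ltP t rho; first by rewrite G0 ?t0// normr0 !mulr0.
  by rewrite ler_wpM2r// (le_trans (wK _ t0 rt))// ler_norm.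
Qed.

Lemma Bernoulli_inequality (x : R) (n : nat) :
  0 <= x -> 1 + n%:R * x <= (1 + x) ^+ n.
Proof.
move=> x0; elim: n => [|n IH]; first by rewrite mul0r addr0 expr0.
rewrite exprS; apply: (@le_trans _ _ ((1 + x) * (1 + n%:R * x))).
  rewrite -natr1; have : 0 <= n%:R * (x * x) by rewrite !mulr_ge0.
  by lra.
by rewrite ler_wpM2l// addr_ge0.
Qed.

(** Linearity in [p]: integrability and vanishing are stable under sums, so monomials suffice. *)
Lemma moments_horner (G : R -> R) (rho : R) : 0 < rho ->
  mu.-integrable `]0, +oo[ (EFin \o G) ->
  (forall t, 0 < t < rho -> G t = 0) ->
  (forall k, \int[mu]_(t in `]0, +oo[) (G t * t^-1 ^+ (2 * k)) = 0) ->
  forall p : {poly R},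
    mu.-integrable `]0, +oo[ (EFin \o (fun t => G t * p.[t^-1 ^+ 2])) /\
    \int[mu]_(t in `]0, +oo[) (G t * p.[t^-1 ^+ 2]) = 0.
Proof.
move=> rho0 iG G0 M p.
pose Q (q : {poly R}) :=
  mu.-integrable `]0, +oo[ (EFin \o (fun t => G t * q.[t^-1 ^+ 2])) /\
  \int[mu]_(t in `]0, +oo[) (G t * q.[t^-1 ^+ 2]) = 0.
rewrite -/(Q p) -(coefK p) poly_def.
apply: (big_ind Q) => [|q r [iq q0] [ir r0]|i _].
- have E : (fun t => G t * (0 : {poly R}).[t^-1 ^+ 2]) = cst 0.
    by apply/funext => t; rewrite horner0 mulr0.
  rewrite /Q E; split; first exact: integrable0.
  by rewrite Rintegral_cst// mul0r.
- have E : (fun t => G t * (q + r).[t^-1 ^+ 2]) =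
      (fun t => G t * q.[t^-1 ^+ 2] + G t * r.[t^-1 ^+ 2]).
    by apply/funext => t; rewrite hornerD mulrDr.
  rewrite /Q E; split; last by rewrite RintegralD// q0 r0 addr0.
  exact: (integrableD _ iq ir).
- have E : (fun t => G t * (p`_i *: 'X^i).[t^-1 ^+ 2]) =
      (fun t => p`_i * (G t * t^-1 ^+ (2 * i))).
    by apply/funext => t; rewrite hornerZ hornerXn mulrCA exprM.
  have iM : mu.-integrable `]0, +oo[ (EFin \o (fun t => G t * t^-1 ^+ (2 * i))).
    apply: (@integrable_mulr_bounded _ _ rho (rho^-1 ^+ (2 * i))) => //.
      by apply: measurable_funX; exact: measurable_funV_gt0.
    move=> t t0 rt; rewrite normrX ger0_norm ?invr_ge0 ?(ltW t0)//.
    have V0 u : 0 < u -> 0 <= u^-1 :> R by rewrite invr_ge0 => /ltW.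
    by rewrite lerXn2r ?nnegrE ?V0// lef_pV2.
  rewrite /Q E; split; first exact: (integrableZl _ p`_i iM).
  by rewrite RintegralZl// M mulr0.
Qed.

(** If [G t0 > 0], integrate [G] against powers of a polynomial [q] in [t^-1 ^+ 2] that exceeds 1
    only near [t0]. The integrals are all 0, yet the part near [t0] grows at least linearly in the
    exponent while the rest stays above minus the integral of [|G|]. Even powers suffice because
    [t^-1 ^+ 2] is injective on the positive half-line. *)
Lemma moments_le0 (G : R -> R) (rho t0 : R) : 0 < rho ->
  mu.-integrable `]0, +oo[ (EFin \o G) ->
  (forall t, 0 < t < rho -> G t = 0) ->
  (forall k, \int[mu]_(t in `]0, +oo[) (G t * t^-1 ^+ (2 * k)) = 0) ->
  0 < t0 -> {for t0, continuous G} -> G t0 <= 0.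
Proof.
move=> rho0 iG G0 M t00 cG; rewrite leNgt; apply/negP => Gt0.
pose c := G t0 / 2.
have c0 : 0 < c by rewrite divr_gt0.
have [e e0 Ge] : exists2 e, 0 < e < t0 & forall t, `|t - t0| < e -> c < G t.
  have : \forall t \near t0, c < G t.
    apply: (cvgr_gt (G t0) cG).
    by rewrite /c ltr_pdivrMr// mulr_natr mulr2n ltrDl.
  move=> /nbhs_ballP[e /= e0 He].
  exists (Num.min e (t0 / 2)).
    rewrite lt_min e0 divr_gt0//= gt_min; apply/orP; right.
    by rewrite ltr_pdivrMr// mulr_natr mulr2n ltrDl.
  by move=> t; rewrite lt_min => /andP[te _]; apply: He; rewrite /ball/= distrC.
have /andP[e_gt0 et0] := e0.
(* [G > c] on []a, b[], and [[a', b']] is a concentric interval of length [e] inside it. *)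
pose a := t0 - e; pose b := t0 + e.
pose a' := t0 - e / 2; pose b' := t0 + e / 2.
have a0 : 0 < a by rewrite subr_gt0.
have aa' : a < a' by rewrite /a /a'; lra.
have ab' : a' < b' by rewrite /a' /b'; lra.
have bb' : b' < b by rewrite /b /b'; lra.
pose sq (t : R) := t^-1 ^+ 2.
have sq_gt0 t : 0 < t -> 0 < sq t by move=> ?; rewrite exprn_gt0// invr_gt0.
have sq_lt t u : 0 < t -> t < u -> sq u < sq t.
  move=> t_gt0 tu; have u_gt0 := lt_trans t_gt0 tu.
  by rewrite ltrXn2r ?nnegrE ?invr_ge0 ?ltW// ltf_pV2.
have sq_le t u : 0 < t -> t <= u -> sq u <= sq t.
  by move=> t_gt0; rewrite le_eqVlt => /predU1P[->//|tu]; exact/ltW/sq_lt.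
pose S := sq rho + sq a + sq b.
have S0 : 0 < S by rewrite !addr_gt0// sq_gt0//; lra.
(* As a function of [t], [q.[t^-1 ^+ 2]] exceeds 1 exactly on ]a, b[, and the
   choice of [S] keeps it in [-1, 1] on the rest of the support of [G]: its
   powers concentrate near [t0]. *)
pose q : {poly R} := 1 + (S ^+ 2)^-1 *: (('X - (sq b)%:P) * ((sq a)%:P - 'X)).
have qE s : q.[s] = 1 + (S ^+ 2)^-1 * ((s - sq b) * (sq a - s)).
  by rewrite /q !hornerE.
(* A lower bound for [q - 1] on [[a', b']], each factor being replaced by its minimum there. *)
pose l := (S ^+ 2)^-1 * ((sq b' - sq b) * (sq a - sq a')).
have l0 : 0 < l.
  rewrite /l mulr_gt0 ?invr_gt0 ?exprn_gt0// mulr_gt0// subr_gt0 sq_lt//; lra.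
pose J : set R := [set` `[a', b']].
(* Pointwise minorant of the integrand, to be integrated over the half-line. On [J] it comes from
   Bernoulli's inequality for [(1 + l) ^+ N]. *)
have key (N : nat) t : 0 < t ->
    (1 + N%:R * l) * c * \1_J t - `|G t| <= G t * (q ^+ N).[sq t].
  move=> tt0; rewrite horner_exp.
  (* Where [G t = 0], the point [t] cannot lie in [J], since [G > c] there. *)
  have [tr|rt] := ltP t rho.
    have Gt : G t = 0 by rewrite G0// tt0.
    rewrite Gt normr0 mul0r subr0 indicE memNset ?mulr0//.
    rewrite /J/= in_itv/= => /andP[h1 h2].
    have : c < G t.
      by apply: Ge; rewrite ltr_norml; move: h1 h2; rewrite /a' /b'; lra.
    by rewrite Gt ltNge ltW.
  have sr : sq t <= sq rho by apply: sq_le.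
  have st0 : 0 < sq t by apply: sq_gt0.
  have norm_le : `|(sq t - sq b) * (sq a - sq t)| <= S ^+ 2.
    have ? : 0 < sq a by exact: sq_gt0.
    have ? : 0 < sq b by apply: sq_gt0; lra.
    have ? : 0 < sq rho by exact: sq_gt0.
    rewrite normrM expr2 ler_pM//; rewrite ler_norml /S; lra.
  (* A nonpositive product of modulus at most [S ^+ 2] puts [q] in [[0, 1]], so the integrand is at
     least [- |G t|]. *)
  have far : (sq t - sq b) * (sq a - sq t) <= 0 ->
      (1 + N%:R * l) * c * 0 - `|G t| <= G t * q.[sq t] ^+ N.
    move=> sign; rewrite mulr0 add0r lerNl; apply: le_trans (ler_norm _) _.
    rewrite normrN normrM ler_piMr// normrX exprn_ile1// qE.
    have S2 : 0 < S ^+ 2 by rewrite exprn_gt0.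
    set v := _^-1 * _; have : `|v| <= 1.
      by rewrite normrM gtr0_norm ?invr_gt0// ler_pdivrMl// mulr1.
    have : v <= 0 by rewrite /v pmulr_rle0// invr_gt0.
    by rewrite !ler_norml; lra.
  have [h1|h1] := leP t a.
    rewrite indicE memNset; last by rewrite /J/= in_itv/= => /andP[]; lra.
    apply: far; rewrite mulr_ge0_le0// ?subr_le0 ?subr_ge0 sq_le//.
    by move: h1 ab' aa' bb'; lra.
  have [h2|h2] := leP b t.
    rewrite indicE memNset; last by rewrite /J/= in_itv/= => /andP[]; lra.
    apply: far; rewrite mulr_le0_ge0// ?subr_le0 ?subr_ge0 sq_le//.
      by move: aa' ab' bb'; lra.
    exact: ltW.
  have Gt : c < G t.
    by apply: Ge; rewrite ltr_norml; move: h1 h2; rewrite /a /b; lra.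
  have G_ge0 : 0 <= G t by rewrite (le_trans (ltW c0))// ltW.
  have qge1 : 1 <= q.[sq t].
    rewrite qE lerDl mulr_ge0 ?invr_ge0 ?sqr_ge0// mulr_ge0// subr_ge0 sq_le//.
      exact: ltW.
    exact: ltW.
  have [/andP[h3 h4]|nJ] := boolP (a' <= t <= b').
    rewrite indicE mem_set ?mulr1; last by rewrite /J/= in_itv/= h3.
    apply: (@le_trans _ _ (c * (1 + N%:R * l))).
      by rewrite mulrC lerBlDr lerDl.
    apply: ler_pM; [exact: ltW| |exact: ltW|].
      by rewrite addr_ge0// mulr_ge0// ltW.
    apply: (le_trans (Bernoulli_inequality _ N (ltW l0))).
    rewrite lerXn2r ?nnegrE ?addr_ge0 ?(ltW l0) ?(le_trans ler01 qge1)//.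
    rewrite qE lerD2l /l ler_wpM2l ?invr_ge0 ?sqr_ge0//.
    apply: ler_pM; rewrite ?subr_ge0.
    - by apply/ltW/sq_lt; lra.
    - by apply/ltW/sq_lt; lra.
    - by rewrite lerD2r sq_le.
    - by rewrite lerD2l lerN2 sq_le//; lra.
  rewrite indicE memNset; last by rewrite /J/= in_itv/=; exact/negP.
  rewrite mulr0 add0r (@le_trans _ _ 0)// ?oppr_le0// mulr_ge0//.
  by rewrite exprn_ge0// (le_trans ler01).
have iN := integrable_norm iG.
have iJ : mu.-integrable `]0, +oo[ (EFin \o (\1_J : R -> R)).
  apply: (@integrableS _ _ _ _ setT) => //.
  exact: integrable_indic_itv.
have mJ : \int[mu]_(t in `]0, +oo[) \1_J t = e.
  have J0 : J `<=` `]0, +oo[.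
    move=> t /=; rewrite !in_itv/= andbT => /andP[h _].
    exact: lt_le_trans (lt_trans a0 aa') h.
  rewrite /Rintegral integral_indic//; last exact: measurable_itv.
  have := lebesgue_measure_itv `[a', b']; rewrite /= lte_fin ab' -EFinB => mJ.
  rewrite setIidl//; transitivity (fine (b' - a')%:E).
    by congr fine; exact: mJ.
  by rewrite /= /a' /b'; lra.
pose I := \int[mu]_(t in `]0, +oo[) `|G t|.
have bound (N : nat) : (1 + N%:R * l) * c * e <= I.
  have [iq q0] := moments_horner _ _ rho0 iG G0 M (q ^+ N).
  have iZ : mu.-integrable `]0, +oo[
    (EFin \o (fun t => (1 + N%:R * l) * c * (\1_J t : R))).
    exact: (integrableZl _ _ iJ).
  rewrite -subr_le0 -q0 -mJ -RintegralZl// -RintegralB//.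
  apply: le_Rintegral => //; first exact: (integrableB _ iZ iN).
  by move=> t /=; rewrite in_itv/= andbT => ?; exact: key.
have I0 : 0 <= I by apply: Rintegral_ge0.
have lce : 0 < l * c * e by exact: mulr_gt0 (mulr_gt0 l0 c0) e_gt0.
have [N HN] : exists N : nat, I < N%:R * (l * c * e).
  exists (Num.truncn (I / (l * c * e))).+1.
  by rewrite -ltr_pdivrMr// truncnS_gt.
have := bound N; apply/negP; rewrite -ltNge (lt_trans HN)//.
rewrite (_ : (1 + N%:R * l) * c * e = c * e + N%:R * (l * c * e)); last by ring.
by rewrite ltrDr; exact: mulr_gt0 c0 e_gt0.
Qed.

(** The one-sided bound is applied to [G] and to [-1 * G]. *)
Lemma moments_eq0 (G : R -> R) (rho t0 : R) : 0 < rho ->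
  mu.-integrable `]0, +oo[ (EFin \o G) ->
  (forall t, 0 < t < rho -> G t = 0) ->
  (forall k, \int[mu]_(t in `]0, +oo[) (G t * t^-1 ^+ (2 * k)) = 0) ->
  0 < t0 -> {for t0, continuous G} -> G t0 = 0.
Proof.
move=> rho0 iG G0 M t00 cG; apply/eqP; rewrite eq_le (@moments_le0 G rho)//=.
have mD : measurable (`]0, +oo[ : set (measurableTypeR R)) by [].
rewrite -oppr_le0 -mulN1r; apply: (@moments_le0 (fun t => -1 * G t) rho) => //.
- exact: (integrableZl mD (-1) iG).
- by move=> t t0r; rewrite G0// mulr0.
- move=> k; have [ik _] := moments_horner _ _ rho0 iG G0 M 'X^k.
  have E : (fun t => G t * 'X^k.[t^-1 ^+ 2]) = (fun t => G t * t^-1 ^+ (2 * k)).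
    by apply/funext => t; rewrite hornerXn exprM.
  rewrite E in ik.
  transitivity (\int[mu]_(t in `]0, +oo[) (-1 * (G t * t^-1 ^+ (2 * k)))).
    by apply: eq_Rintegral => t _; rewrite mulrA.
  by rewrite RintegralZl// M mulr0.
- by apply: cvgM => //; exact: cvg_cst.
Qed.

End moments.

(** * Differentiation of beam integrals *)

Section beam.
Context {R : realType} {n : nat}.
Let mu := @lebesgue_measure R.
Implicit Types (phi : 'rV[R]_n -> R) (x y v xi : 'rV[R]_n) (i j : 'I_n).

(** Decay in the coordinate [y = x + t * xi] becomes decay in [t]: substitute [t = (y - x) / xi] and
    use [(y - x) ^+ 2 <= 2 * (1 + x ^+ 2) * (1 + y ^+ 2)]. *)
Lemma le_oneDsqrV (x xi t a C : R) : xi != 0 -> 0 <= a ->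
  (1 + (x + t * xi) ^+ 2) * a <= C ->
  a <= C * (1 + 2 * (1 + x ^+ 2) / xi ^+ 2) * (oneDsqr t)^-1.
Proof.
move=> xi0 a0 aC.
have xi2 : 0 < xi ^+ 2 by rewrite exprn_even_gt0.
have D0 : 0 < oneDsqr t by apply: lt_le_trans (oneDsqr_ge1 t).
rewrite ler_pdivlMr//.
set y := x + t * xi in aC.
have tE : t = (y - x) / xi by rewrite /y addrC addKr mulfK.
have le1 : oneDsqr t <= (1 + y ^+ 2) * (1 + 2 * (1 + x ^+ 2) / xi ^+ 2).
  rewrite /oneDsqr {1}tE expr_div_n.
  have : (y - x) ^+ 2 / xi ^+ 2 <= 2 * (1 + x ^+ 2) * (1 + y ^+ 2) / xi ^+ 2.
    rewrite ler_wpM2r ?invr_ge0 ?(ltW xi2)//.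
    have := sqr_ge0 (x + y); have := sqr_ge0 (x * y); nra.
  have := sqr_ge0 y; rewrite -!mulrA; set k := _^-1; lra.
apply: (@le_trans _ _ (a * ((1 + y ^+ 2) * (1 + 2 * (1 + x ^+ 2) / xi ^+ 2)))).
  by rewrite ler_wpM2l.
rewrite mulrA [a * _]mulrC ler_wpM2r// addr_ge0// mulr_ge0 ?invr_ge0 ?(ltW xi2)//.
by rewrite mulr_ge0// addr_ge0// sqr_ge0.
Qed.

Lemma is_derive_line phi y v (u : R) : derivable phi (y + u *: v) v ->
  is_derive u 1 (fun u => phi (y + u *: v)) ('D_v phi (y + u *: v)).
Proof.
have E : (fun h : R => h^-1 *: (((fun u => phi (y + u *: v)) \o shift u) (h *: 1)
                              - phi (y + u *: v))) =
         (fun h : R => h^-1 *: ((phi \o shift (y + u *: v)) (h *: v) -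
                                phi (y + u *: v))).
  apply/funext => h; congr (_ *: (_ - _)) => /=; congr phi.
  by rewrite [h%:A]mulr1 scalerDl addrCA.
move=> dphi; split; first by rewrite /derivable E.
by rewrite /derive E.
Qed.

Lemma is_derive_line_scaled phi y v (c u : R) :
  derivable phi (y + (u * c) *: v) v ->
  is_derive u 1 (fun u => phi (y + (u * c) *: v))
    (c * 'D_v phi (y + (u * c) *: v)).
Proof.
move=> dphi.
have h1 := is_derive_line _ _ _ _ dphi.
have h2 : is_derive u 1 (fun u : R => u * c) c.
  by apply: is_derive_eq; rewrite scaler0 add0r /GRing.scale/= mulr1.
have := @is_derive1_comp _ (fun u => phi (y + u *: v)) _ u _ _ h1 h2.
by rewrite mulrC.
Qed.

(** Decay of order two in a single coordinate is enough for integrability along every ray whose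
    direction has a nonzero [i]-th coordinate. *)
Definition decays i (f : 'rV[R]_n -> R) :=
  exists C : R, forall y, (1 + y 0 i ^+ 2) * `|f y| <= C.

Lemma continuous_line phi x v :
  continuous phi -> continuous (fun t : R => phi (x + t *: v)).
Proof.
move=> cphi t; apply: (@continuous_comp _ _ _ (fun t : R => x + t *: v) phi);
  last exact: cphi.
by apply: cvgD; [exact: cvg_cst|apply: cvgZr_tmp; exact: cvg_id].
Qed.

Lemma integrable_beam phi x xi i :
  continuous phi -> decays i phi -> xi 0 i != 0 ->
  mu.-integrable `]0, +oo[ (EFin \o (fun t => phi (x + t *: xi))).
Proof.
move=> cphi [C bC] xi0.
have mD : measurable (`]0, +oo[ : set (measurableTypeR R)) by [].
pose K := C * (1 + 2 * (1 + x 0 i ^+ 2) / xi 0 i ^+ 2).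
apply: (le_integrable mD _ _ (integrableZl mD K integrable_oneDsqrV)).
  apply/measurable_EFinP; apply: continuous_measurable_funS.
  exact: continuous_line.
move=> t _ /=; rewrite lee_fin; apply: le_trans (ler_norm _).
by apply: le_oneDsqrV => //; have := bC (x + t *: xi); rewrite !mxE.
Qed.

(* The moving direction [delta_mx 0 j] leaves the [i]-th coordinate unchanged, so
   decay in that coordinate gives a bound integrable in [t] and uniform in [u].
   The choices [s = cst 1] and [s = id] move the source and the direction. *)
Lemma is_derive_beam phi x xi i j (s w : R -> R) (u0 r rho K : R) :
  continuous phi -> (forall y, derivable phi y (delta_mx 0 j)) ->
  decays i phi -> decays i ('D_(delta_mx 0 j) phi) ->
  xi 0 i != 0 -> i != j ->
  continuous s -> measurable_fun (`]0, +oo[ : set R) w ->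
  0 < r ->
  (forall u t, u0 - r < u < u0 + r -> 0 < t < rho ->
    phi (x + t *: xi + (u * s t) *: delta_mx 0 j) = 0) ->
  (forall t, 0 < t -> rho <= t -> `|w t| <= K) ->
  (forall t, 0 < t -> rho <= t -> `|s t * w t| <= K) ->
  is_derive u0 1
    (fun u => \int[mu]_(t in `]0, +oo[)
                (phi (x + t *: xi + (u * s t) *: delta_mx 0 j) * w t))
    (\int[mu]_(t in `]0, +oo[)
       ('D_(delta_mx 0 j) phi (x + t *: xi + (u0 * s t) *: delta_mx 0 j) *
        (s t * w t))).
Proof.
move=> cphi dphi [C bC] [C' bC'] xi0 ij cs mw r0 zero wK swK.
have mD : measurable (`]0, +oo[ : set (measurableTypeR R)) by [].
pose P u t := x + t *: xi + (u * s t) *: delta_mx 0 j : 'rV[R]_n.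
pose f u t := phi (P u t) * w t.
have Pi u t : (P u t) 0 i = x 0 i + t * xi 0 i.
  by rewrite !mxE/= (negbTE ij) mulr0 addr0.
have u0r : (u0 - r < u0 < u0 + r) by rewrite ltrBlDr ltrDl r0.
pose k := 1 + 2 * (1 + x 0 i ^+ 2) / xi 0 i ^+ 2.
have k0 : 0 <= k.
  rewrite addr_ge0// mulr_ge0 ?invr_ge0 ?sqr_ge0// mulr_ge0//.
  by rewrite addr_ge0// sqr_ge0.
have phiK u t : `|phi (P u t)| <= C * k * (oneDsqr t)^-1.
  by apply: le_oneDsqrV => //; have := bC (P u t); rewrite Pi.
have dphiK u t : `|'D_(delta_mx 0 j) phi (P u t)| <= C' * k * (oneDsqr t)^-1.
  by apply: le_oneDsqrV => //; have := bC' (P u t); rewrite Pi.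
have cP u : continuous (fun t => phi (P u t)).
  move=> t; apply: (@continuous_comp _ _ _ (P u) phi); last exact: cphi.
  apply: cvgD.
    by apply: cvgD; [exact: cvg_cst|apply: cvgZr_tmp; exact: cvg_id].
  by apply: cvgZr_tmp; apply: cvgM; [exact: cvg_cst|exact: cs].
have iphi u : mu.-integrable `]0, +oo[ (EFin \o (fun t => phi (P u t))).
  apply: (le_integrable mD _ _ (integrableZl mD (C * k) integrable_oneDsqrV)).
    by apply/measurable_EFinP; apply: continuous_measurable_funS; exact: cP.
  move=> t _ /=; rewrite lee_fin; apply: le_trans (ler_norm _); exact: phiK.
have df (u t : R) : is_derive u (1 : R) (f ^~ t)
    ('D_(delta_mx 0 j) phi (P u t) * (s t * w t)).
  have h := is_derive_line_scaled _ _ _ _ _ (dphi (P u t)).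
  apply: is_derive_eq; rewrite scaler0 add0r.
  by rewrite /GRing.scale/= -/(P u t); ring.
have d1E (u t : R) :
    partial1of2 f u t = 'D_(delta_mx 0 j) phi (P u t) * (s t * w t).
  by rewrite partial1of2E; exact: derive_val.
have C'0 : 0 <= C'.
  by apply: le_trans (bC' 0); rewrite mulr_ge0// addr_ge0// sqr_ge0.
pose I := `]u0 - r, u0 + r[.
have H1 u : [set` I] u -> mu.-integrable `]0, +oo[ (EFin \o f u).
  rewrite /I/= in_itv/= => uI.
  by apply: (integrable_mulr_bounded _ _ rho K) => // t t0; exact: zero.
have H2 (u t : R) :
    [set` I] u -> `]0, +oo[%classic t -> derivable (f ^~ t) u (1 : R).
  by move=> _ _; exact: ex_derive.
(* The dominating function, independent of [u]; the absolute value of [K] keeps it nonnegative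
   whatever the sign of [K]. *)
pose G t := C' * k * `|K| * (oneDsqr t)^-1.
have H3 t : 0 <= G t.
  by rewrite !mulr_ge0// invr_ge0 (le_trans ler01 (oneDsqr_ge1 _)).
have H4 : mu.-integrable `]0, +oo[ (EFin \o G).
  exact: (integrableZl mD (C' * k * `|K|) integrable_oneDsqrV).
have H5 (u t : R) :
    [set` I] u -> `]0, +oo[%classic t -> `|partial1of2 f u t| <= G t.
  rewrite /I /= !in_itv/= andbT => uI t0.
  (* For [t < rho] the integrand vanishes for all parameters near [u], so its [u]-derivative is 0
     even where the weight is not bounded by [K]. *)
  have [tr|rt] := ltP t rho.
    suff -> : partial1of2 f u t = 0 by rewrite normr0.
    have uI' : u \in I by rewrite /I in_itv.
    rewrite partial1of2E (@near_eq_derive _ _ _ _ (cst 0)).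
      by rewrite derive_cst.
    near=> v; rewrite /f zero ?mul0r ?t0//.
    by near: v; exact: near_in_itvoo uI'.
  rewrite d1E normrM /G mulrAC ler_pM//.
  by apply: le_trans (swK t t0 rt) _; exact: ler_norm.
have u0I : [set` I] u0 by rewrite /I/= in_itv.
have := derivable_under_integral mD u0I H1 H2 H3 H4 H5.
move=> dd; split; first exact: dd.
have := differentiation_under_integral mD u0I H1 H2 H3 H4 H5.
rewrite derive1E => ->; apply: eq_Rintegral => t _; exact: d1E.
Unshelve. all: by end_near. Qed.

End beam.

(** * Vanishing of the moments along lines *)

Section moments_of_beams.
Context {R : realType} {n : nat}.
Let mu := @lebesgue_measure R.
Implicit Types (phi : 'rV[R]_n -> R) (x y v xi : 'rV[R]_n) (i j : 'I_n).

(** What the argument uses of the real or imaginary part of a Schwartz function. *)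
Definition tame phi := [/\ continuous phi,
  forall j y, derivable phi y (delta_mx 0 j),
  forall i, decays i phi &
  forall i j, decays i ('D_(delta_mx 0 j) phi)].

(** The integral [A_m] of the overview; [m = 0] gives the divergent beam transform. The singularity
    of the weight at 0 is harmless when [phi] vanishes near [x]. *)
Definition beam phi (m : nat) x xi : R :=
  \int[mu]_(t in `]0, +oo[) (phi (x + t *: xi) * t^-1 ^+ m).

Definition line_moment phi m x xi : R :=
  beam phi m x xi + (-1) ^+ m * beam phi m x (- xi).

Lemma coord_neq0 xi : xi != 0 -> exists i, xi 0 i != 0.
Proof.
move=> xi0; apply: contrapT => H; case/eqP: xi0; apply/rowP => i; rewrite mxE.
by apply/eqP; apply: contrapT => /negP H'; apply: H; exists i.
Qed.

(* Any two nonzero vectors are joined by moves along coordinate axes that keep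
   another coordinate nonzero throughout. *)
Lemma eq_on_nonzero (F : 'rV[R]_n -> R) :
  (2 <= n)%N ->
  (forall xi i j b, i != j -> xi 0 i != 0 ->
    F (xi + b *: delta_mx 0 j) = F xi) ->
  forall xi eta, xi != 0 -> eta != 0 -> F xi = F eta.
Proof.
move=> n2 FD.
have same i (xi eta : 'rV[R]_n) :
    xi 0 i = eta 0 i -> xi 0 i != 0 -> F xi = F eta.
  move=> E xi0.
  have eta_sum : eta = xi + \sum_j (eta - xi) 0 j *: delta_mx 0 j.
    by rewrite -row_sum_delta addrC subrK.
  (* Coordinates are changed one at a time. The [i]-th increment is zero, so the [i]-th coordinate
     stays nonzero and every other move is allowed. *)
  have H (s : seq 'I_n) :
      let v := xi + \sum_(j <- s) (eta - xi) 0 j *: delta_mx 0 j in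
      F v = F xi /\ v 0 i = xi 0 i.
    elim: s => [|j s /= [IH IH0]]; first by rewrite /= big_nil addr0.
    rewrite /= big_cons addrCA addrC.
    have [<-|ij] := eqVneq i j; last first.
      rewrite (FD _ i j)// ?IH0//; split => //.
      by rewrite mxE IH0 !mxE/= (negbTE ij) mulr0 addr0.
    have -> : (eta - xi) 0 i = 0 by rewrite !mxE E subrr.
    by rewrite scale0r addr0.
  by rewrite {1}eta_sum; case: (H (index_enum _)).
have other (i : 'I_n) : exists j : 'I_n, i != j.
  have [->|i0] := eqVneq i (Ordinal (ltnW n2)); first by exists (Ordinal n2).
  by exists (Ordinal (ltnW n2)).
have set_coord j c (v : 'rV[R]_n) : (v + (c - v 0 j) *: delta_mx 0 j) 0 j = c.
  by rewrite !mxE/= eqxx mulr1 addrC subrK.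
move=> xi eta /coord_neq0[i xi0] /coord_neq0[k eta0].
(* If [i = k], set a further coordinate [j] to 1 in both vectors, which then share it. Otherwise
   give [xi] the [k]-th coordinate of [eta]. *)
have [ik|ik] := eqVneq i k.
  rewrite -{k}ik in eta0.
  have [j ij] := other i.
  rewrite -(FD xi i j (1 - xi 0 j))// -(FD eta i j (1 - eta 0 j))//.
  by apply: (same j); rewrite !set_coord ?oner_eq0.
by rewrite -(FD xi i k (eta 0 k - xi 0 k))//; apply: (same k); rewrite set_coord.
Qed.

Lemma measurable_invX m :
  measurable_fun (`]0, +oo[ : set R) (fun t : R => t^-1 ^+ m).
Proof. by apply: measurable_funX; exact: measurable_funV_gt0. Qed.

Lemma invX_bound m (rho t : R) :
  0 < rho -> 0 < t -> rho <= t -> `|t^-1 ^+ m| <= rho^-1 ^+ m.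
Proof.
move=> rho0 t0 rt; rewrite normrX ger0_norm ?invr_ge0 ?(ltW t0)//.
by rewrite lerXn2r ?nnegrE ?invr_ge0 ?(ltW rho0) ?(ltW t0)// lef_pV2.
Qed.

Lemma is_derive_addZ (f g : R -> R) (c a df dg : R) :
  is_derive a (1 : R) f df -> is_derive a (1 : R) g dg ->
  is_derive a (1 : R) (fun t => f t + c * g t) (df + c * dg).
Proof.
by move=> hf hg; apply: is_derive_eq.
Qed.

(** * Moments at a source around which [phi] vanishes *)

Section fixed_source.
Variables (phi : 'rV[R]_n -> R) (x : 'rV[R]_n) (r : R).
Hypothesis tphi : tame phi.
Hypothesis r0 : 0 < r.
Hypothesis zphi : forall y, `|y - x| < r -> phi y = 0.

(** For [|t|] below this value [x + t *: xi] stays in the ball where [phi] vanishes; the [+ 1] keeps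
    the denominator positive. *)
Let radius xi := r / (`|xi| + 1).

Let radius_gt0 xi : 0 < radius xi.
Proof. by rewrite divr_gt0// ltr_wpDl. Qed.

Let zline xi t : `|t| < radius xi -> phi (x + t *: xi) = 0.
Proof.
rewrite ltr_pdivlMr ?ltr_wpDl// => h; apply: zphi.
rewrite addrC addKr normrZ (le_lt_trans _ h)// ler_wpM2l// lerDl//.
Qed.

(** Halving lets a displacement of the source and one along the ray share the radius [r]. *)
Let half_radius (t : R) xi : `|t| < radius xi / 2 -> `|t| * `|xi| < r / 2.
Proof.
rewrite /radius mulrAC ltr_pdivlMr ?ltr_wpDl// => /(le_lt_trans _) -> //.
by rewrite ler_wpM2l// lerDl.
Qed.

Lemma integrable_beam_moment m xi : xi != 0 ->
  mu.-integrable `]0, +oo[ (EFin \o (fun t => phi (x + t *: xi) * t^-1 ^+ m)).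
Proof.
case: tphi => cphi dphi bphi bdphi /coord_neq0[i xi0].
apply: (@integrable_mulr_bounded _ _ _ (radius xi) ((radius xi)^-1 ^+ m)).
- exact: (integrable_beam _ _ _ i).
- by move=> t /andP[t0 tr]; apply: zline; rewrite gtr0_norm.
- exact: measurable_invX.
- by move=> t t0 rt; exact: invX_bound.
Qed.

Lemma continuous_beam_moment m xi :
  continuous (fun t : R => phi (x + t *: xi) * t^-1 ^+ m).
Proof.
case: tphi => cphi _ _ _ t.
(* Near [t = 0] the factor [phi (x + t *: xi)] is identically zero, which cancels the singular
   weight. *)
have [->|t0] := eqVneq t 0.
  have E : phi (x + 0 *: xi) * 0^-1 ^+ m = 0.
    by rewrite zline ?mul0r// normr0.
  rewrite /continuous_at E; apply: cvg_near_cst.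
  have : \forall s \near (0 : R), `|s| < radius xi by exact: nbhs0_lt.
  by apply: filterS => s sr; rewrite zline ?mul0r.
apply: cvgM; first exact: (continuous_line phi x xi cphi t).
apply: (@continuous_comp _ _ _ (fun t : R => t^-1) (fun t : R => t ^+ m)).
  exact: inv_continuous.
exact: exprn_continuous.
Qed.

(** Substituting [2 * t] for [t] yields a factor [2 ^+ m.+1] from the weight and [1 / 2] from the
    measure. *)
Lemma beam_scale2 m xi :
  xi != 0 -> beam phi m.+1 x (2 *: xi) = 2 ^+ m * beam phi m.+1 x xi.
Proof.
move=> xi0; rewrite /beam.
have xi20 : 2 *: xi != 0 by rewrite scaler_eq0 negb_or xi0 pnatr_eq0.
have := @Rintegral_affine R 2 0 _ (ltr0Sn _ _) (continuous_beam_moment m.+1 xi).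
rewrite -/mu => <-.
have mD : measurable (`]0, +oo[ : set (measurableTypeR R)) by [].
rewrite -[LHS](@mulVKf _ ((2 : R) ^+ m)) ?expf_neq0 ?pnatr_eq0//; congr (_ * _).
rewrite -RintegralZl//; last exact: integrable_beam_moment.
apply: eq_Rintegral => t _.
rewrite addr0 scalerA [t * 2]mulrC invfM exprMn [2^-1 ^+ m.+1]exprS.
set p := phi _; set q := t^-1 ^+ _; rewrite exprVn; field.
by rewrite expf_neq0// pnatr_eq0.
Qed.

(** The common derivative of two motions: shifting the source with weight [t^-1 ^+ m], or turning
    the direction with weight [t^-1 ^+ m.+1], where the chain rule supplies a factor [t]. *)
Definition dbeam j m xi : R :=
  \int[mu]_(t in `]0, +oo[) ('D_(delta_mx 0 j) phi (x + t *: xi) * t^-1 ^+ m).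

Lemma is_derive_beam_source m xi i j : i != j -> xi 0 i != 0 ->
  is_derive (0 : R) (1 : R) (fun u : R => beam phi m (x + u *: delta_mx 0 j) xi)
    (dbeam j m xi).
Proof.
case: tphi => cphi dphi bphi bdphi ij xi0.
pose rho := radius xi / 2; pose r' := radius (delta_mx 0 j : 'rV[R]_n) / 2.
have rho0 : 0 < rho by rewrite divr_gt0.
have r'0 : 0 < r' by rewrite divr_gt0.
have := @is_derive_beam R n phi x xi i j (cst 1) (fun t => t^-1 ^+ m) 0 r' rho
  (rho^-1 ^+ m) cphi (dphi j) (bphi i) (bdphi i j) xi0 ij (fun=> cvg_cst _)
  (measurable_invX m) r'0.
have -> : (fun u : R => \int[lebesgue_measure]_(t in `]0, +oo[)
    (phi (x + t *: xi + (u * cst 1 t) *: delta_mx 0 j) * t^-1 ^+ m)) =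
    (fun u : R => beam phi m (x + u *: delta_mx 0 j) xi).
  apply/funext => u; apply: eq_Rintegral => t _.
  by rewrite /cst mulr1 addrAC.
rewrite /dbeam.
under eq_Rintegral do rewrite mul0r scale0r addr0 mul1r.
apply.
- move=> u t; rewrite sub0r add0r -ltr_norml => ur /andP[t0 tr].
  apply: zphi; rewrite -(addrA x) [x + (_ + _)]addrC addrK.
  rewrite (le_lt_trans (ler_normD _ _))//.
  rewrite mulr1 !normrZ [ltRHS](splitr r) ltrD// half_radius// gtr0_norm//.
- by move=> t t0 rt; exact: invX_bound.
- by move=> t t0 rt; rewrite mul1r; exact: invX_bound.
Qed.

Lemma is_derive_beam_direction m xi i j (b : R) : i != j -> xi 0 i != 0 ->
  is_derive b (1 : R) (fun u : R => beam phi m.+1 x (xi + u *: delta_mx 0 j))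
    (dbeam j m (xi + b *: delta_mx 0 j)).
Proof.
case: tphi => cphi dphi bphi bdphi ij xi0.
(* [N] bounds the norm of [xi + u *: delta_mx 0 j] for [u] within distance 1 of [b], so [rho] works
   uniformly for these directions. *)
pose N := `|xi| + (`|b| + 1) * `|delta_mx 0 j : 'rV[R]_n|.
have N0 : 0 <= N by rewrite addr_ge0// mulr_ge0// addr_ge0.
pose rho := r / (N + 1).
have rho0 : 0 < rho by rewrite divr_gt0// ltr_wpDl.
have cid : continuous (id : R -> R) by move=> t; exact: cvg_id.
(* The bound is a sum: its first term controls [t * t^-1 ^+ m.+1], its second the weight itself. *)
have := @is_derive_beam R n phi x xi i j id (fun t => t^-1 ^+ m.+1) b 1 rho
  (rho^-1 ^+ m + rho^-1 ^+ m.+1) cphi (dphi j) (bphi i) (bdphi i j) xi0 ij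
  cid (measurable_invX m.+1) ltr01.
have -> : (fun u : R => \int[lebesgue_measure]_(t in `]0, +oo[)
    (phi (x + t *: xi + (u * id t) *: delta_mx 0 j) * t^-1 ^+ m.+1)) =
    (fun u : R => beam phi m.+1 x (xi + u *: delta_mx 0 j)).
  apply/funext => u; apply: eq_Rintegral => t _.
  by rewrite scalerDr addrA scalerA [t * u]mulrC.
have -> : \int[lebesgue_measure]_(t in `]0, +oo[)
   ('D_(delta_mx 0 j) phi (x + t *: xi + (b * id t) *: delta_mx 0 j) *
    (id t * t^-1 ^+ m.+1)) = dbeam j m (xi + b *: delta_mx 0 j).
  apply: eq_Rintegral => t; rewrite inE/= in_itv/= andbT => t0.
  by rewrite scalerDr addrA scalerA [t * b]mulrC exprS mulVKf// gt_eqF.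
have X0 k : 0 <= rho^-1 ^+ k by rewrite exprn_ge0// invr_ge0 ltW.
apply.
- move=> u t /andP[bu ub] /andP[t0 tr].
  apply: zphi; rewrite -(addrA x) [x + (_ + _)]addrC addrK.
  rewrite (le_lt_trans (ler_normD _ _))//.
  rewrite 2!normrZ [`|u * t|]normrM (gtr0_norm t0) [_ * t]mulrC -mulrA -mulrDr.
  apply: (@le_lt_trans _ _ (t * (N + 1)));
    last by rewrite -ltr_pdivlMr// ltr_wpDl.
  rewrite ler_wpM2l ?ltW// /N.
  have ub1 : `|u| <= `|b| + 1.
    rewrite ler_norml; have := ler_norm b.
    by have := ler_norm (- b); rewrite normrN; lra.
  have := ler_wpM2r (normr_ge0 (delta_mx 0 j : 'rV[R]_n)) ub1; lra.
- by move=> t t0 rt; rewrite (le_trans (invX_bound _ _ _ rho0 t0 rt))// lerDr.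
- move=> t t0 rt; rewrite /= exprS mulVKf ?gt_eqF//.
  by rewrite (le_trans (invX_bound _ _ _ rho0 t0 rt))// lerDl.
Qed.

Hypothesis n2 : (2 <= n)%N.

(* Both sides of [d/dxi_j line_moment m.+1 = d/dx_j line_moment m] equal
   [dbeam j m xi + (-1) ^+ m * dbeam j m (- xi)]. *)
Lemma line_moment_direction m :
  (forall x' xi, `|x' - x| < r -> xi != 0 -> line_moment phi m x' xi = 0) ->
  forall xi i j b, i != j -> xi 0 i != 0 ->
    line_moment phi m.+1 x (xi + b *: delta_mx 0 j) = line_moment phi m.+1 x xi.
Proof.
move=> M0 xi i j b ij xi0.
pose h (u : R) := line_moment phi m.+1 x (xi + u *: delta_mx 0 j).
suff h0 u : is_derive u (1 : R) h 0.
  by have := @is_derive_0_is_cst R h b 0 h0; rewrite /h scale0r addr0.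
set v := xi + u *: delta_mx 0 j.
have vi : v 0 i != 0 by rewrite !mxE/= (negbTE ij) mulr0 addr0.
have Nvi : (- v) 0 i != 0 by rewrite mxE oppr_eq0.
have v0 : v != 0 by apply: contra_neq vi => ->; rewrite mxE.
have d0 : dbeam j m v + (-1) ^+ m * dbeam j m (- v) = 0.
  pose k (a : R) := line_moment phi m (x + a *: delta_mx 0 j) v.
  have dk : is_derive (0 : R) (1 : R) k
      (dbeam j m v + (-1) ^+ m * dbeam j m (- v)).
    have h1 := is_derive_beam_source m v i j ij vi.
    have h2 := is_derive_beam_source m (- v) i j ij Nvi.
    exact: (is_derive_addZ _ _ _ _ _ _ h1 h2).
  (* The moments of order [m] vanish for all sources near [x], so [k] is zero near 0. *)
  have : is_derive (0 : R) (1 : R) k 0.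
    apply: (@near_eq_is_derive _ _ _ (cst 0)).
    have : \forall a \near (0 : R), `|a| < radius (delta_mx 0 j : 'rV[R]_n).
      exact: nbhs0_lt.
    apply: filterS => a ar; rewrite /k M0// addrC addKr normrZ.
    move: ar; rewrite ltr_pdivlMr ?ltr_wpDl//; apply: le_lt_trans.
    by rewrite ler_wpM2l// lerDl.
  by move=> [_ <-]; apply/esym; exact: derive_val.
have h1 := is_derive_beam_direction m xi i j u ij xi0.
have Nxi0 : (- xi) 0 i != 0 by rewrite mxE oppr_eq0.
have h2 := is_derive_beam_direction m (- xi) i j (- u) ij Nxi0.
have h3 : is_derive u (1 : R) (fun u : R => - u) (-1).
  exact: is_deriveN.
have h4 := @is_derive1_comp _ _ _ u _ _ h2 h3.
have -> : h = (fun u : R => beam phi m.+1 x (xi + u *: delta_mx 0 j)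
     + (-1) ^+ m.+1 *
       ((fun a : R => beam phi m.+1 x (- xi + a *: delta_mx 0 j)) \o -%R) u).
  by apply/funext => a; rewrite /h /line_moment /= opprD scaleNr.
have h5 := is_derive_addZ _ _ ((-1) ^+ m.+1) _ _ _ h1 h4.
(* The opposite ray turns by [- u]; the resulting factor [-1] changes [(-1) ^+ m.+1] into
   [(-1) ^+ m]. *)
suff <- : dbeam j m v + (-1) ^+ m.+1 *
    (dbeam j m (- xi + - u *: delta_mx 0 j) * -1) = 0
  by exact: h5.
by rewrite scaleNr -opprD -/v exprS mulN1r mulrN1 mulrNN.
Qed.

Lemma line_moment1N xi : line_moment phi 1 x (- xi) = - line_moment phi 1 x xi.
Proof. by rewrite /line_moment opprK expr1 !mulN1r opprB addrC. Qed.

Lemma line_moment_step m :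
  (forall x' xi, `|x' - x| < r -> xi != 0 -> line_moment phi m x' xi = 0) ->
  forall xi, xi != 0 -> line_moment phi m.+1 x xi = 0.
Proof.
move=> M0 xi xi0.
have C := eq_on_nonzero _ n2 (line_moment_direction _ M0).
(* The moment of order 1 has degree 0, so doubling says nothing about it and oddness is used
   instead. For higher orders doubling multiplies a constant by a factor greater than 1. *)
case: m M0 C => [|m] M0 C.
  have := C xi (- xi) xi0; rewrite oppr_eq0 line_moment1N => /(_ xi0) h.
  by lra.
have xi20 : 2 *: xi != 0 by rewrite scaler_eq0 negb_or xi0 pnatr_eq0.
have Nxi0 : - xi != 0 by rewrite oppr_eq0.
have S :
    line_moment phi m.+2 x (2 *: xi) = 2 ^+ m.+1 * line_moment phi m.+2 x xi.
  by rewrite /line_moment -scalerN !beam_scale2// mulrDr mulrCA.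
have := C xi (2 *: xi) xi0 xi20; rewrite S => /eqP.
rewrite -subr_eq0 -{1}[line_moment _ _ _ _]mul1r -mulrBl mulf_eq0.
move=> /orP[|/eqP//].
rewrite subr_eq0 => /eqP h.
have : 1 < (2 : R) ^+ m.+1 by rewrite exprn_egt1// ltr1n.
by rewrite -h ltxx.
Qed.

(** Twice the value at [x + xi] is the sum at [t = 1] of the even part [E] and the weighted odd part
    [D] of [phi] on the line; both vanish by [moments_eq0]. *)
Lemma zero_on_line xi : xi != 0 ->
  (forall m, line_moment phi m x xi = 0) -> phi (x + xi) = 0.
Proof.
move=> xi0 M0.
have mD : measurable (`]0, +oo[ : set (measurableTypeR R)) by [].
have Nxi0 : - xi != 0 by rewrite oppr_eq0.
pose E t := phi (x + t *: xi) + phi (x + t *: - xi).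
(* The extra factor [t^-1] makes the even moments of [D] the line moments of odd order. *)
pose D t := phi (x + t *: xi) * t^-1 ^+ 1 + - (phi (x + t *: - xi) * t^-1 ^+ 1).
have z t : 0 < t < radius xi ->
    phi (x + t *: xi) = 0 /\ phi (x + t *: - xi) = 0.
  move=> /andP[t0 tr]; split; apply: zline; rewrite gtr0_norm//.
  by rewrite /radius normrN.
have b0 v : v != 0 ->
    mu.-integrable `]0, +oo[ (EFin \o (fun t => phi (x + t *: v))).
  move=> v0; have := integrable_beam_moment 0 v v0.
  by congr (_ .-integrable _ _); apply/funext => t /=; rewrite expr0 mulr1.
have cb v : continuous (fun t : R => phi (x + t *: v)).
  by case: tphi => cphi _ _ _; exact: continuous_line.
have sgn k : (-1 : R) ^+ (2 * k) = 1 by rewrite exprM sqrrN !expr1n.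
(* The even and odd parts of [phi] on the line see only the moments of even,
   respectively odd, index. *)
have E1 : E 1 = 0.
  apply: (@moments_eq0 R E (radius xi) 1) => //.
  - exact: (integrableD mD (b0 _ xi0) (b0 _ Nxi0)).
  - by move=> t /z[h1 h2]; rewrite /E h1 h2 addr0.
  - move=> k; transitivity (line_moment phi (2 * k) x xi); last exact: M0.
    rewrite /line_moment sgn mul1r.
    rewrite -RintegralD//; [|exact: integrable_beam_moment..].
    by apply: eq_Rintegral => t _; rewrite mulrDl.
  - by apply: cvgD; exact: cb.
have D1 : D 1 = 0.
  apply: (@moments_eq0 R D (radius xi) 1) => //.
  - exact: (integrableB mD (integrable_beam_moment 1 _ xi0)
                           (integrable_beam_moment 1 _ Nxi0)).
  - by move=> t /z[h1 h2]; rewrite /D h1 h2 !mul0r subrr.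
  - move=> k; transitivity (line_moment phi (2 * k).+1 x xi); last exact: M0.
    rewrite /line_moment exprS sgn mulr1 mulN1r.
    rewrite -RintegralB//; [|exact: integrable_beam_moment..].
    by apply: eq_Rintegral => t _; rewrite mulrBl expr1 !exprS !mulrA.
  - apply: cvgD; first exact: continuous_beam_moment.
    by apply: cvgN; exact: continuous_beam_moment.
move: E1 D1; rewrite /E /D invr1 expr1 !mulr1 !scale1r; lra.
Qed.

End fixed_source.

Theorem tame_eq0 phi x0 r : tame phi -> (2 <= n)%N -> 0 < r ->
  (forall y, `|y - x0| < r -> phi y = 0) ->
  (forall y xi, `|y - x0| < r -> xi != 0 -> beam phi 0 y xi = 0) ->
  forall y, phi y = 0.
Proof.
move=> tphi n2 r0 zphi beam0 y.
have M m : forall x xi, `|x - x0| < r -> xi != 0 -> line_moment phi m x xi = 0.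
  elim: m => [x xi xr xi0|m IH x xi xr xi0].
    by rewrite /line_moment !beam0 ?oppr_eq0// mulr0 addr0.
  (* The induction step differentiates in the source, so it is run on a smaller ball around each
     [x]. *)
  have near_x z : `|z - x| < r - `|x - x0| -> `|z - x0| < r.
    move=> h; rewrite -(subrK x z) -addrA (le_lt_trans (ler_normD _ _))//.
    by rewrite -ltrBrDr.
  apply: (@line_moment_step phi x (r - `|x - x0|)) => //.
  - by rewrite subr_gt0.
  - by move=> z /near_x; exact: zphi.
  - by move=> z v /near_x; exact: IH.
have [->|yx] := eqVneq y x0; first by rewrite zphi// subrr normr0.
rewrite -(subrK x0 y) addrC; apply: (@zero_on_line phi x0 r) => //.
  by rewrite subr_eq0.
by move=> m; apply: M; rewrite ?subrr ?normr0 ?subr_eq0.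
Qed.

End moments_of_beams.

(** * Schwartz functions *)

Section source.
Context {R : realType}.
Let mu := @lebesgue_measure R.

(** Subtracting two tails gives a zero integral over []0, u]] for a small [u]. If [g 0] were
    nonzero, continuity would keep that integral within [|g 0| / 2 * u] of [g 0 * u]. *)
Lemma tails_eq0 (g : R -> R) (e : R) : 0 < e ->
  continuous g -> mu.-integrable `]0, +oo[ (EFin \o g) ->
  (forall u, 0 <= u < e -> \int[mu]_(t in `]0, +oo[) g (t + u) = 0) -> g 0 = 0.
Proof.
move=> e0 cg ig tail0; apply/eqP; apply: contrapT => /negP g0.
have mitv (i : interval R) :
    measurable ([set` i] : set (measurableTypeR R)) by [].
have n0 : 0 < `|g 0| by rewrite normr_gt0.
have half0 : 0 < `|g 0| / 2 by rewrite divr_gt0.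
have /cvgrPdist_lt/(_ _ half0) := cg 0.
move=> /nbhs_ballP[d /= d0 Hd].
pose u := Num.min e d / 2.
have u0 : 0 < u by rewrite divr_gt0// lt_min e0.
have ue : u < e.
  rewrite /u ltr_pdivrMr// (@le_lt_trans _ _ e) ?ge_min ?lexx//.
  by rewrite ltr_pMr// ltr1n.
have ud : u < d.
  rewrite /u ltr_pdivrMr// (@le_lt_trans _ _ d) ?ge_min ?lexx ?orbT//.
  by rewrite ltr_pMr// ltr1n.
have tailu : \int[mu]_(t in `]u, +oo[) g t = 0.
  rewrite /mu -(@Rintegral_affine R 1 u g ltr01 cg) -[RHS](tail0 u) ?(ltW u0)//.
  by apply: eq_Rintegral => t _; rewrite mul1r mulr1.
have U : `]0, +oo[%classic = `]0, u]%classic `|` `]u, +oo[%classic :> set R.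
  apply/seteqP; split => t /=; rewrite !in_itv/= !andbT.
    by move=> ->; have [tu|ut] := leP t u; [left|right].
  by move=> [/andP[]//|]; exact: lt_trans.
have iu : mu.-integrable `]0, u] (EFin \o g).
  apply: (integrableS (mitv `]0, +oo[) _ _ ig) => // t /=.
  by rewrite !in_itv/= andbT => /andP[].
have head0 : \int[mu]_(t in `]0, u]) g t = 0.
  have := tail0 0; rewrite lexx e0 => /(_ isT).
  under eq_Rintegral do rewrite addr0.
  rewrite U Rintegral_setU//; first by rewrite tailu addr0.
    by rewrite -U.
  rewrite disj_set2E; apply/eqP; rewrite -subset0 => t [] /=.
  by rewrite !in_itv/= andbT => /andP[_ tu]; rewrite ltNge tu.
have mu_u : fine (mu `]0, u]) = u.
  have := lebesgue_measure_itv `]0, u]; rewrite /= lte_fin u0 -EFinB subr0 => h.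
  by rewrite /mu; move: h => /= ->.
have icst (c : R) : mu.-integrable `]0, u] (EFin \o cst c).
  apply: measurable_bounded_integrable => //; last exact: bounded_cst.
  rewrite /mu; have := lebesgue_measure_itv `]0, u].
  by rewrite /= lte_fin u0 => ->; rewrite -EFinB ltry.
have ig0 : mu.-integrable `]0, u] (EFin \o (fun t => g t - g 0)).
  exact: (integrableB _ iu (icst (g 0))).
have E : \int[mu]_(t in `]0, u]) (g t - g 0) = - (g 0 * u).
  rewrite RintegralB//; last exact: icst.
  by rewrite head0 Rintegral_cst// mu_u sub0r.
have : `|\int[mu]_(t in `]0, u]) (g t - g 0)| <= `|g 0| / 2 * u.
  rewrite -[X in _ * X]mu_u -Rintegral_cst//.
  apply: (le_trans (le_normr_Rintegral _ ig0)) => //.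
  apply: le_Rintegral => //; [exact: integrable_norm|exact: icst|].
  move=> t /=; rewrite in_itv/= => /andP[t0 tu]; rewrite distrC ltW//.
  by apply: Hd; rewrite /ball/= sub0r normrN gtr0_norm// (le_lt_trans tu).
rewrite E normrN normrM (gtr0_norm u0) -subr_le0 -mulrBl pmulr_lle0//.
lra.
Qed.
End source.

(** * Reduction of Schwartz functions to tame real functions *)

Section schwartz.
Context {R : realType} {n : nat}.
Implicit Types (f : 'rV[R]_n -> R[i]) (x : 'rV[R]_n).

Lemma normc_le_parts (z : R[i]) (M : R) : (`|z| <= M%:C)%C ->
  `|complex.Re z| <= M /\ `|complex.Im z| <= M.
Proof.
case: z => a b; rewrite normc_def /= lecR => zM.
split; apply: le_trans zM; rewrite -sqrtr_sqr ler_sqrt ?addr_ge0 ?sqr_ge0//.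
  by rewrite lerDl sqr_ge0.
by rewrite lerDr sqr_ge0.
Qed.

Lemma mpartial_indicator j f : mpartial (fun k => k == j : nat) f = partial j f.
Proof.
rewrite /mpartial.
have H (s : seq 'I_n) : uniq s ->
    foldr (fun i g => iter (i == j) (partial i) g) f s =
    if j \in s then partial j f else f.
  elim: s => // i s IH /= /andP[is_ us]; rewrite IH// inE eq_sym.
  by have [->|//] := eqVneq j i; rewrite /= (negbTE is_).
by rewrite H ?enum_uniq// mem_enum.
Qed.

Lemma mpartial0 f : mpartial (fun=> 0%N) f = f.
Proof. by rewrite /mpartial; elim: (enum _). Qed.

Lemma monomial0 x : monomial (fun=> 0%N) x = 1.
Proof. by rewrite /monomial big1. Qed.

Lemma monomial_sqr i x :
  monomial (fun k => if k == i then 2 else 0)%N x = x 0 i ^+ 2.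
Proof.
rewrite /monomial (bigD1 i)//= eqxx big1 ?mulr1// => k /negbTE ->.
by rewrite expr0.
Qed.

(** The weight [1 + y 0 i ^+ 2] is the sum of two monomials, so two of the Schwartz bounds are
    added. *)
Lemma schwartz_decays i f b : schwartz f ->
  decays i (fun y => complex.Re (mpartial b f y)) /\
  decays i (fun y => complex.Im (mpartial b f y)).
Proof.
move=> [_ H].
have [M0 H0] := H (fun=> 0%N) b.
have [M2 H2] := H (fun k => if k == i then 2 else 0)%N b.
suff K (y : 'rV[R]_n) :
    (1 + y 0 i ^+ 2) * `|complex.Re (mpartial b f y)| <= M0 + M2 /\
    (1 + y 0 i ^+ 2) * `|complex.Im (mpartial b f y)| <= M0 + M2.
  by split; exists (M0 + M2) => y; have [] := K y.
have := H0 y; rewrite monomial0 => /normc_le_parts.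
have := H2 y; rewrite monomial_sqr => /normc_le_parts.
case: (mpartial b f y) => p q /=.
rewrite !mul0r !subr0 !addr0 !mul1r !(normrM (y 0 i ^+ 2)).
rewrite (ger0_norm (sqr_ge0 _)) => -[a1 a2] [b1 b2].
by split; rewrite mulrDl mul1r lerD.
Qed.

Lemma schwartz_tame f : schwartz f ->
  tame (fun y => complex.Re (f y)) /\ tame (fun y => complex.Im (f y)).
Proof.
move=> sf; have [sm _] := sf; have [[cR cI] d] := sm [::].
have D0 i := schwartz_decays i _ (fun=> 0%N) sf.
have D1 i j := schwartz_decays i _ (fun k => k == j : nat) sf.
split; split => //.
- by move=> j y; have [] := d j y.
- by move=> i; have [] := D0 i; rewrite mpartial0.
- by move=> i j; have [] := D1 i j; rewrite mpartial_indicator.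
- by move=> j y; have [] := d j y.
- by move=> i; have [] := D0 i; rewrite mpartial0.
- by move=> i j; have [] := D1 i j; rewrite mpartial_indicator.
Qed.

(** On a ball inside [U], the beams along one axis from [y + u *: delta_mx 0 j], for small [u], are
    tails of a single integral; [tails_eq0] then gives [phi y = 0], as [tame_eq0] requires. *)
Lemma tame_beam_eq0 (phi : 'rV[R]_n -> R) (U : set 'rV[R]_n) :
  (2 <= n)%N -> tame phi -> open U -> U !=set0 ->
  (forall x, U x -> forall xi, xi != 0 -> beam phi 0 x xi = 0) ->
  forall x, phi x = 0.
Proof.
move=> n2 tphi oU [x0 Ux0] beam0.
have [r r0 rU] : exists2 r : R, 0 < r & forall y, `|y - x0| < r -> U y.
  have /nbhs_ballP[r /= r0 rU] := open_nbhs_nbhs (conj oU Ux0).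
  exists r => // y yr; apply: rU; rewrite -ball_normE /=.
  by rewrite distrC.
pose j : 'I_n := Ordinal (ltnW n2).
have e0 : (delta_mx 0 j : 'rV[R]_n) != 0.
  by apply/eqP => /rowP/(_ j); rewrite !mxE !eqxx => /eqP; rewrite oner_eq0.
apply: (tame_eq0 _ _ _ tphi n2 r0);
  last by move=> y xi /rU Uy xi0; exact: beam0.
move=> y yr; case: tphi => cphi _ dphi _.
have ry : 0 < (r - `|y - x0|) / (`|delta_mx 0 j : 'rV[R]_n| + 1).
  by rewrite divr_gt0 ?subr_gt0// ltr_wpDl.
have N1 : 0 < `|delta_mx 0 j : 'rV[R]_n| + 1 by rewrite ltr_wpDl.
have := @tails_eq0 R (fun t => phi (y + t *: delta_mx 0 j)) _ ry.
rewrite scale0r addr0; apply.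
- exact: continuous_line.
- by apply: (integrable_beam _ _ _ j) => //; rewrite mxE !eqxx oner_eq0.
- move=> u /andP[u0]; rewrite ltr_pdivlMr// => ur.
  have Uu : U (y + u *: delta_mx 0 j).
    apply: rU; rewrite addrAC (le_lt_trans (ler_normD _ _))// -ltrBrDl.
    by rewrite normrZ (ger0_norm u0) (le_lt_trans _ ur)// ler_wpM2l// lerDl.
  transitivity (beam phi 0 (y + u *: delta_mx 0 j) (delta_mx 0 j));
    last exact: beam0 Uu _ e0.
  apply: eq_Rintegral => t _.
  by rewrite expr0 mulr1 scalerDl addrA addrAC.
Qed.

Lemma beam0E (phi : 'rV[R]_n -> R) x xi :  xi != 0 -> tame phi ->
  beam phi 0 x xi = \int[@lebesgue_measure R]_(t in `[0, +oo[) phi (x + t *: xi).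
Proof.
move=> /coord_neq0[i xi0] [cphi _ dphi _].
rewrite -Rintegral_itv_obnd_cbnd; last exact: (integrable_beam _ _ _ i).
by apply: eq_Rintegral => t _; rewrite expr0 mulr1.
Qed.

End schwartz.

Theorem theorem6p1 (R : realType) (n : nat) (hn : (2 <= n)%N)
  (f : 'rV[R]_n -> R[i]) (hf : schwartz f)
  (U : set 'rV[R]_n) (hU : open U) (hU0 : U !=set0)
  (hD : forall x, U x -> forall xi : 'rV[R]_n, xi != 0 ->
     divergent_beam f x xi = 0) :
  forall x : 'rV[R]_n, f x = 0.
Proof.
move=> x; have [tR tI] := schwartz_tame _ hf.
have Re0 : complex.Re (f x) = 0.
  apply: (tame_beam_eq0 (fun y => complex.Re (f y)) U) => // y Uy xi xi0.
  by rewrite beam0E//; have [] := hD y Uy xi xi0.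
have Im0 : complex.Im (f x) = 0.
  apply: (tame_beam_eq0 (fun y => complex.Im (f y)) U) => // y Uy xi xi0.
  by rewrite beam0E//; have [] := hD y Uy xi xi0.
by move: Re0 Im0; case: (f x) => a b /= -> ->.
Qed.
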